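(* Let $\begin{pmatrix}x\\ y\end{pmatrix},\begin{pmatrix}a\\ b\end{pmatrix}\in\mathbb{O}^2\smallsetminus\left\{\begin{pmatrix}0\\ 0\end{pmatrix}\right\}$ and let $A\in\widehat{Spin(9)}$. If $$\Phi\begin{pmatrix}x\\ y\end{pmatrix}=\Phi\begin{pmatrix}a\\ b\end{pmatrix},\qquad\text{then}\qquad \Phi\left(A\begin{pmatrix}x\\ y\end{pmatrix}\right)=\Phi\left(A\begin{pmatrix}a\\ b\end{pmatrix}\right).$$
   Context: $\mathbb{O}$ is the normed division algebra of octonions. $\Phi$ is the octonionic Hopf map from $\mathbb{O}^2$ to the $2\times2$ traceless Hermitian octonionic matrices, $$\Phi\begin{pmatrix}x\\ y\end{pmatrix}=\begin{pmatrix}\frac{|x|^2-|y|^2}{2}&x\bar{y}\\ y\bar{x}&\frac{|y|^2-|x|^2}{2}\end{pmatrix}.$$ $\widehat{Spin(9)}\cong Spin(9)$ is the subgroup of $\mathrm{End}_{\mathbb{R}}(\mathbb{O}\oplus\mathbb{O})$ generated by the $\mathbb{R}$-linear maps $$g(r,u)\begin{pmatrix}x\\ y\end{pmatrix}=\begin{pmatrix}rx+\bar u y\\ ux-ry\end{pmatrix},\qquad r\in\mathbb{R},\ u\in\mathbb{O},\ r^2+|u|^2=1.$$ *)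

(* Defs.v *)
From HB Require Import structures.
From mathcomp Require Import all_boot all_order all_algebra.
From mathcomp Require Import ring.
From mathcomp Require Import reals.

Set Implicit Arguments.
Unset Strict Implicit.
Unset Printing Implicit Defensive.

Import Order.TTheory GRing.Theory Num.Theory.
Local Open Scope ring_scope.

(* Cayley-Dickson doubling of a (not necessarily associative) algebra T with
   product mul and conjugation conj.  The octonions are the third double of
   the reals; MathComp has no structure for non-associative algebras, so the
   product is a plain function. *)
Definition cd_mul (T : zmodType) (mul : T -> T -> T) (conj : T -> T)
    (p q : T * T) : T * T :=
  (mul p.1 q.1 - mul (conj q.2) p.2, mul q.2 p.1 + mul p.2 (conj q.1)).

Definition cd_conj (T : zmodType) (conj : T -> T) (p : T * T) : T * T :=
  (conj p.1, - p.2).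

Definition cd_norm2 (R : nmodType) (T : Type) (norm2 : T -> R) (p : T * T) : R :=
  norm2 p.1 + norm2 p.2.

Definition octonion (R : realType) : Type :=
  ((R^o * R^o) * (R^o * R^o)) * ((R^o * R^o) * (R^o * R^o)).

HB.instance Definition _ (R : realType) := Vector.on (octonion R).

Definition omul (R : realType) : octonion R -> octonion R -> octonion R :=
  cd_mul (cd_mul (cd_mul (fun a b : R^o => (a : R) * b) id) (cd_conj id))
         (cd_conj (cd_conj id)).

Definition oconj (R : realType) : octonion R -> octonion R :=
  cd_conj (cd_conj (cd_conj id)).

Definition onorm (R : realType) (x : octonion R) : R :=
  Num.sqrt (cd_norm2 (cd_norm2 (cd_norm2 (fun a : R^o => (a : R) ^+ 2))) x).

Definition oreal (R : realType) (a : R) : octonion R :=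
  (((a, 0), (0, 0)), ((0, 0), (0, 0))).

Declare Scope octonion_scope.
Delimit Scope octonion_scope with oct.
Notation "x *o y" := (omul x y) (at level 40, left associativity) : octonion_scope.
Notation "x ^~o" := (oconj x) (at level 2, format "x ^~o") : octonion_scope.
Local Open Scope octonion_scope.

Section OctonionTheory.
Variable R : realType.
Implicit Types x y : octonion R.

Lemma onorm_sqr x : onorm x ^+ 2 =
  cd_norm2 (cd_norm2 (cd_norm2 (fun a : R^o => (a : R) ^+ 2))) x.
Proof. by rewrite sqr_sqrtr // /cd_norm2 !addr_ge0 ?sqr_ge0. Qed.

Lemma omul_linearr x : linear (fun y : octonion R => x *o y).
Proof.
case: x => [[[x0 x1] [x2 x3]] [[x4 x5] [x6 x7]]] k.
move=> [[[y0 y1] [y2 y3]] [[y4 y5] [y6 y7]]] [[[z0 z1] [z2 z3]] [[z4 z5] [z6 z7]]].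
rewrite /omul /cd_mul /cd_conj /=.
by repeat congr (_, _); rewrite /GRing.scale /= -?[k *: _]/(k * (_ : R)); ring.
Qed.

Lemma omul_conj x : x *o x^~o = oreal (onorm x ^+ 2).
Proof.
rewrite onorm_sqr; case: x => [[[x0 x1] [x2 x3]] [[x4 x5] [x6 x7]]].
rewrite /omul /oreal /oconj /cd_norm2 /cd_mul /cd_conj /=.
by repeat congr (_, _); rewrite /=; ring.
Qed.

Lemma onormM x y : onorm (x *o y) = onorm x * onorm y.
Proof.
apply/eqP; rewrite -(@eqrXn2 _ 2) ?mulr_ge0 ?sqrtr_ge0 // exprMn !onorm_sqr.
case: x y => [[[x0 x1] [x2 x3]] [[x4 x5] [x6 x7]]] [[[y0 y1] [y2 y3]] [[y4 y5] [y6 y7]]].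
rewrite /omul /cd_norm2 /cd_mul /cd_conj /=; apply/eqP; ring.
Qed.

End OctonionTheory.

Definition hopf (R : realType) (v : octonion R * octonion R) :
    'M[octonion R]_2 :=
  let: (x, y) := v in
  let d := (onorm x ^+ 2 - onorm y ^+ 2) / 2 in
  let d' := (onorm y ^+ 2 - onorm x ^+ 2) / 2 in
  \matrix_(i < 2, j < 2)
    nth 0 (nth [::] [:: [:: oreal d; x *o y^~o];
                        [:: y *o x^~o; oreal d']] i) j.

Lemma hopf_traceless_hermitian (R : realType) (v : octonion R * octonion R) :
  \tr (hopf v) = 0 /\ (map_mx (@oconj R) (hopf v))^T = hopf v.
Proof.
case: v => x y; split.
  rewrite /mxtrace !big_ord_recl big_ord0 !mxE /= addr0.
  set p := onorm x ^+ 2; set q := onorm y ^+ 2.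
  have orealD (a b : R) : oreal a + oreal b = oreal (a + b).
    by repeat congr (_, _); rewrite /= ?addr0.
  have pq0 : (p - q) / 2 + (q - p) / 2 = 0 by field.
  by rewrite orealD pq0.
have conj_real a : (oreal a)^~o = oreal a :> octonion R.
  by rewrite /oreal /oconj /cd_conj /= !oppr0.
have conjM (z w : octonion R) : (z *o w^~o)^~o = w *o z^~o.
  case: z w => [[[z0 z1] [z2 z3]] [[z4 z5] [z6 z7]]] [[[w0 w1] [w2 w3]] [[w4 w5] [w6 w7]]].
  rewrite /omul /oconj /cd_mul /cd_conj /=.
  by repeat congr (_, _); rewrite /=; ring.
apply/matrixP => i j; rewrite !mxE.
move: i j; do 2!(case; case=> [|[|//]] ?); rewrite /= ?conj_real ?conjM; reflexivity.
Qed.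

Definition spin9_gen_fun (R : realType) (r : R) (u : octonion R)
    (v : octonion R * octonion R) : octonion R * octonion R :=
  let: (x, y) := v in (r *: x + u^~o *o y, u *o x - r *: y).

Fact spin9_gen_fun_linear (R : realType) (r : R) (u : octonion R) :
  linear (spin9_gen_fun r u).
Proof.
have aux (V : lmodType R) (a k : R) (p p' q q' : V) :
  a *: (k *: p + p') + (k *: q + q') = k *: (a *: p + q) + (a *: p' + q').
  by rewrite !scalerDr !scalerA (mulrC k) addrACA.
move=> k [x y] [x' y']; congr (_, _) => /=.
  by rewrite (omul_linearr u^~o k y y'); exact: aux.
rewrite (omul_linearr u k x x') -!scaleNr ![_ + (- r) *: _]addrC.
exact: aux.
Qed.

HB.instance Definition _ (R : realType) (r : R) (u : octonion R) :=
  GRing.isLinear.Build R _ _ _ (spin9_gen_fun r u) (spin9_gen_fun_linear r u).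

Definition spin9_gen (R : realType) (r : R) (u : octonion R) :
    'End((octonion R * octonion R)%type) := linfun (spin9_gen_fun r u).

Lemma spin9_genE (R : realType) (r : R) (u x y : octonion R) :
  spin9_gen r u (x, y) = (r *: x + u^~o *o y, u *o x - r *: y).
Proof. by rewrite lfunE. Qed.

(* Subgroup generated by the g(r, u) inside the monoid 'End under composition.
   The inverse is characterized by its two defining equations because
   (_^-1)%VF is a pseudo-inverse, defined for non-invertible maps as well. *)
Inductive spin9hat (R : realType) : 'End((octonion R * octonion R)%type) -> Prop :=
| spin9hat_gen (r : R) (u : octonion R) :
    r ^+ 2 + onorm u ^+ 2 = 1 -> spin9hat (spin9_gen r u)
| spin9hat_id : spin9hat \1%VF
| spin9hat_comp A B : spin9hat A -> spin9hat B -> spin9hat (A \o B)%VF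
| spin9hat_inv A B : spin9hat A -> (A \o B)%VF = \1%VF ->
    (B \o A)%VF = \1%VF -> spin9hat B.

(* Main.v *)
(** The fibres of the Hopf map [Phi] are the joint fibres of [x *o y^~o],
    [|x|^2] and [|y|^2]: the identity
    [(|x|^2 + |y|^2)^2 = (|x|^2 - |y|^2)^2 + 4 |x *o y^~o|^2] recovers the norms
    from [Phi].  These three quantities at [g(r, u) v] are functions of their
    values at [v]; for the product this is the Moufang identity
    [(u^~ y)(x^~ u^~) = u^~ (y x^~) u^~].  So a generator preserves the relation
    [Phi v = Phi w], and it reflects it as well because [g(r, u)] is an
    involution.  Maps that preserve and reflect the relation are closed under
    composition and inverses. *)
Require Import Defs.
From mathcomp Require Import all_boot all_order all_algebra.
From mathcomp Require Import ring lra.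
From mathcomp Require Import reals.

Import Order.TTheory GRing.Theory Num.Theory.
Local Open Scope ring_scope.
Local Open Scope octonion_scope.

Section OctonionIdentities.
Variable R : realType.
Implicit Types (r : R) (u x y z : octonion R).

(** A folded coordinate form: case analysis through [octP] yields terms on which [octD], [octZ],
    [octM] and [oct_conj] rewrite, so that [ring] closes each coordinate. *)
Definition oct (a0 a1 a2 a3 a4 a5 a6 a7 : R) : octonion R :=
  (((a0, a1), (a2, a3)), ((a4, a5), (a6, a7))).

Definition ore x : R := x.1.1.1.

Variant oct_spec : octonion R -> Type :=
  OctSpec a0 a1 a2 a3 a4 a5 a6 a7 : oct_spec (oct a0 a1 a2 a3 a4 a5 a6 a7).

Lemma octP x : oct_spec x.
Proof. by case: x => [[[a0 a1] [a2 a3]] [[a4 a5] [a6 a7]]]. Qed.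

Lemma octD a0 a1 a2 a3 a4 a5 a6 a7 b0 b1 b2 b3 b4 b5 b6 b7 :
  oct a0 a1 a2 a3 a4 a5 a6 a7 + oct b0 b1 b2 b3 b4 b5 b6 b7 =
  oct (a0 + b0) (a1 + b1) (a2 + b2) (a3 + b3)
      (a4 + b4) (a5 + b5) (a6 + b6) (a7 + b7).
Proof. by []. Qed.

Lemma octZ r a0 a1 a2 a3 a4 a5 a6 a7 :
  r *: oct a0 a1 a2 a3 a4 a5 a6 a7 =
  oct (r * a0) (r * a1) (r * a2) (r * a3) (r * a4) (r * a5) (r * a6) (r * a7).
Proof. by []. Qed.

Lemma oct_conj a0 a1 a2 a3 a4 a5 a6 a7 :
  (oct a0 a1 a2 a3 a4 a5 a6 a7)^~o =
  oct a0 (- a1) (- a2) (- a3) (- a4) (- a5) (- a6) (- a7).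
Proof. by []. Qed.

Lemma octM a0 a1 a2 a3 a4 a5 a6 a7 b0 b1 b2 b3 b4 b5 b6 b7 :
  oct a0 a1 a2 a3 a4 a5 a6 a7 *o oct b0 b1 b2 b3 b4 b5 b6 b7 =
  oct (a0 * b0 - a1 * b1 - a2 * b2 - a3 * b3 - a4 * b4 - a5 * b5 - a6 * b6 - a7 * b7)
      (a0 * b1 + a1 * b0 + a2 * b3 - a3 * b2 + a4 * b5 - a5 * b4 - a6 * b7 + a7 * b6)
      (a0 * b2 - a1 * b3 + a2 * b0 + a3 * b1 + a4 * b6 + a5 * b7 - a6 * b4 - a7 * b5)
      (a0 * b3 + a1 * b2 - a2 * b1 + a3 * b0 + a4 * b7 - a5 * b6 + a6 * b5 - a7 * b4)
      (a0 * b4 - a1 * b5 - a2 * b6 - a3 * b7 + a4 * b0 + a5 * b1 + a6 * b2 + a7 * b3)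
      (a0 * b5 + a1 * b4 - a2 * b7 + a3 * b6 - a4 * b1 + a5 * b0 - a6 * b3 + a7 * b2)
      (a0 * b6 + a1 * b7 + a2 * b4 - a3 * b5 - a4 * b2 + a5 * b3 + a6 * b0 - a7 * b1)
      (a0 * b7 - a1 * b6 + a2 * b5 + a3 * b4 - a4 * b3 - a5 * b2 + a6 * b1 + a7 * b0).
Proof.
rewrite /omul /oct /cd_mul /cd_conj /=.
by repeat congr (_, _); rewrite /=; ring.
Qed.

Lemma oct_norm a0 a1 a2 a3 a4 a5 a6 a7 :
  onorm (oct a0 a1 a2 a3 a4 a5 a6 a7) ^+ 2 =
  a0 ^+ 2 + a1 ^+ 2 + a2 ^+ 2 + a3 ^+ 2 + a4 ^+ 2 + a5 ^+ 2 + a6 ^+ 2 + a7 ^+ 2.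
Proof. by rewrite onorm_sqr /oct /cd_norm2 /= !addrA. Qed.

Lemma oreal_inj : injective (@oreal R).
Proof. by move=> a b []. Qed.

Lemma onorm_conj x : onorm x^~o = onorm x.
Proof. by rewrite /onorm /cd_norm2 /oconj /cd_conj /= !sqrrN. Qed.

Lemma oconjK x : x^~o^~o = x.
Proof. by case: x / octP => *; rewrite !oct_conj !opprK. Qed.

(* Prevents unification from comparing products coordinate by coordinate. *)
#[local] Opaque omul oconj.

Lemma oconjD x y : (x + y)^~o = x^~o + y^~o.
Proof.
case: x / octP => *; case: y / octP => *.
by rewrite octD !oct_conj octD -!opprD.
Qed.

Lemma oconjZ r x : (r *: x)^~o = r *: x^~o.
Proof. by case: x / octP => *; rewrite octZ !oct_conj octZ !mulrN. Qed.

Lemma oconjM x y : (x *o y)^~o = y^~o *o x^~o.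
Proof.
case: x / octP => *; case: y / octP => *; rewrite !(octM, oct_conj).
congr oct; ring.
Qed.

Lemma oreZ r x : ore (r *: x) = r * ore x.
Proof. by []. Qed.

Lemma oreMC x y : ore (x *o y) = ore (y *o x).
Proof.
case: x / octP => *; case: y / octP => *; rewrite !octM /ore /=; ring.
Qed.

(** Associators are purely imaginary. With [oreMC], the real part of a triple product is thus free
    of bracketing and invariant under cyclic shifts. *)
Lemma oreMA x y z : ore (x *o (y *o z)) = ore (x *o y *o z).
Proof.
case: x / octP => *; case: y / octP => *; case: z / octP => *.
rewrite !octM /ore /=; ring.
Qed.

Lemma omulDr x y z : x *o (y + z) = x *o y + x *o z.
Proof. by have := omul_linearr x 1 y z; rewrite !scale1r. Qed.

Lemma omulZr r x y : x *o (r *: y) = r *: (x *o y).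
Proof.
have mulx0 : x *o 0 = 0 by apply: (addrI (x *o 0)); rewrite -omulDr !addr0.
by have := omul_linearr x r y 0; rewrite mulx0 !addr0.
Qed.

(** Conjugation reverses products and so carries right-hand laws to left-hand ones. *)
Lemma omulDl x y z : (x + y) *o z = x *o z + y *o z.
Proof. by apply: (can_inj oconjK); rewrite oconjD !oconjM oconjD omulDr. Qed.

Lemma omulZl r x y : (r *: x) *o y = r *: (x *o y).
Proof. by apply: (can_inj oconjK); rewrite oconjZ !oconjM oconjZ omulZr. Qed.

(** A form of left alternativity, since [x^~o] lies in the real span of 1 and [x]. *)
Lemma omulKl x y : x^~o *o (x *o y) = onorm x ^+ 2 *: y.
Proof.
case: x / octP => *; case: y / octP => *.
rewrite oct_norm !(octM, oct_conj, octZ).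
congr oct; ring.
Qed.

Lemma omulKVl x y : x *o (x^~o *o y) = onorm x ^+ 2 *: y.
Proof. by rewrite -{1}[x]oconjK omulKl onorm_conj. Qed.

Lemma omulKVr x y : x *o y *o y^~o = onorm y ^+ 2 *: x.
Proof. by apply: (can_inj oconjK); rewrite !oconjM oconjZ omulKl onorm_conj. Qed.

Lemma omul_moufang u x y : (u *o x) *o (y *o u) = u *o ((x *o y) *o u).
Proof.
case: u / octP => *; case: x / octP => *; case: y / octP => *.
rewrite !octM.
congr oct; ring.
Qed.

Lemma onormD x y :
  onorm (x + y) ^+ 2 = onorm x ^+ 2 + onorm y ^+ 2 + 2 * ore (x *o y^~o).
Proof.
case: x / octP => *; case: y / octP => *.
rewrite octD !oct_norm oct_conj octM /ore /=; ring.
Qed.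

Lemma onormZ r x : onorm (r *: x) ^+ 2 = r ^+ 2 * onorm x ^+ 2.
Proof. by case: x / octP => *; rewrite octZ !oct_norm !exprMn -!mulrDr. Qed.

(** The cross term is the real part of [x *o (y^~o *o u)]; reassociating and shifting cyclically
    isolates [x *o y^~o]. *)
Lemma onorm_gen1 r u x y :
  onorm (r *: x + u^~o *o y) ^+ 2 =
  r ^+ 2 * onorm x ^+ 2 + onorm u ^+ 2 * onorm y ^+ 2 +
  2 * r * ore (u *o (x *o y^~o)).
Proof.
rewrite onormD onormZ onormM onorm_conj exprMn oconjM oconjK omulZl oreZ.
by rewrite oreMA oreMC mulrA.
Qed.

Lemma onorm_gen2 r u x y :
  onorm (u *o x - r *: y) ^+ 2 =
  onorm u ^+ 2 * onorm x ^+ 2 + r ^+ 2 * onorm y ^+ 2 -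
  2 * r * ore (u *o (x *o y^~o)).
Proof.
rewrite -scaleNr onormD onormZ sqrrN onormM exprMn oconjZ omulZr oreZ.
by rewrite -oreMA mulNr mulrN mulrA.
Qed.

(** Of the four products in the expansion, [x *o (x^~o *o u^~o)] and [u^~o *o y *o y^~o] collapse by
    alternativity to multiples of [u^~o], and the one with [u^~o] on both sides needs Moufang. *)
Lemma omul_gen r u x y :
  (r *: x + u^~o *o y) *o (u *o x - r *: y)^~o =
  (r * (onorm x ^+ 2 - onorm y ^+ 2)) *: u^~o - r ^+ 2 *: (x *o y^~o) +
  u^~o *o ((x *o y^~o)^~o *o u^~o).
Proof.
rewrite -scaleNr oconjD oconjZ !oconjM oconjK omulDr !omulDl !omulZr !omulZl.
rewrite omulKVl omulKVr omul_moufang !scalerA mulrBr scalerBl !mulNr !scaleNr.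
by rewrite -expr2 addrAC [X in _ + X + _]addrC addrA.
Qed.

End OctonionIdentities.

Section HopfFibres.
Variable R : realType.
Implicit Types (r : R) (u x y a b : octonion R) (v w : octonion R * octonion R).

Lemma hopf_eqP x y a b :
  hopf (x, y) = hopf (a, b) <->
  [/\ x *o y^~o = a *o b^~o, onorm x ^+ 2 = onorm a ^+ 2 &
      onorm y ^+ 2 = onorm b ^+ 2].
Proof.
split=> [hE|[pE nx ny]]; last first.
  have qE : y *o x^~o = b *o a^~o.
    by rewrite -[y]oconjK -[b]oconjK -!oconjM pE.
  by apply/matrixP => i j; rewrite !mxE nx ny pE qE.
have /oreal_inj dE : oreal ((onorm x ^+ 2 - onorm y ^+ 2) / 2) =
    oreal ((onorm a ^+ 2 - onorm b ^+ 2) / 2).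
  by move/matrixP/(_ 0 0): hE; rewrite !mxE.
have pE : x *o y^~o = a *o b^~o by move/matrixP/(_ 0 1): hE; rewrite !mxE.
(* Multiplicativity of the norm reads this product off the off-diagonal entry. *)
have nE : onorm x ^+ 2 * onorm y ^+ 2 = onorm a ^+ 2 * onorm b ^+ 2.
  by rewrite -!exprMn -(onorm_conj _ y) -(onorm_conj _ b) -!onormM pE.
have sE : onorm x ^+ 2 + onorm y ^+ 2 = onorm a ^+ 2 + onorm b ^+ 2.
  apply/eqP; rewrite -(@eqrXn2 _ 2) ?addr_ge0 ?sqr_ge0 //; apply/eqP.
  have sqE (p q : R) :
      (p + q) ^+ 2 = 4 * ((p - q) / 2) ^+ 2 + 4 * (p * q) by field.
  by rewrite !sqE dE nE.
by split=> //; lra.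
Qed.

Lemma hopf_spin9_gen r u v w :
  hopf v = hopf w -> hopf (spin9_gen r u v) = hopf (spin9_gen r u w).
Proof.
case: v w => [x y] [a b] /hopf_eqP[pE nx ny].
rewrite !spin9_genE; apply/hopf_eqP; split.
- by rewrite [LHS]omul_gen [RHS]omul_gen pE nx ny.
- by rewrite [LHS]onorm_gen1 [RHS]onorm_gen1 pE nx ny.
- by rewrite [LHS]onorm_gen2 [RHS]onorm_gen2 pE nx ny.
Qed.

(** The mixed terms cancel and alternativity leaves the scalar [r ^+ 2 + onorm u ^+ 2]. *)
Lemma spin9_genK r u : r ^+ 2 + onorm u ^+ 2 = 1 ->
  involutive (spin9_gen r u).
Proof.
move=> ru1 [x y]; rewrite !spin9_genE.
have omulB z p q : z *o (p - r *: q) = z *o p - r *: (z *o q) :> octonion R.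
  by rewrite omulDr -scaleNr omulZr scaleNr.
congr (_, _).
  rewrite omulB omulKl scalerDr scalerA addrACA subrr addr0.
  by rewrite -scalerDl -expr2 ru1 scale1r.
rewrite omulDr omulZr omulKVl scalerBr scalerA opprB.
by rewrite addrC addrA subrK -scalerDl -expr2 ru1 scale1r.
Qed.

Lemma hopf_spin9hat (A : 'End((octonion R * octonion R)%type)) v w :
  spin9hat A -> hopf v = hopf w <-> hopf (A v) = hopf (A w).
Proof.
move=> sA; elim: sA v w => {A} [r u ru1||A B _ IHA _ IHB|A B _ IHA AB1 _] v w.
- split; first exact: hopf_spin9_gen.
  by move/(hopf_spin9_gen r u); rewrite !spin9_genK.
- by rewrite !id_lfunE.
- by rewrite !comp_lfunE IHB IHA.
(* The equivalence for [A] at [B v] and [B w], read backwards, is the one for [B], because [A]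
   undoes [B]. *)
- by rewrite (IHA (B v) (B w)) -!comp_lfunE AB1 !id_lfunE.
Qed.

End HopfFibres.

Theorem proposition24 (R : realType) (x y a b : octonion R)
    (A : 'End((octonion R * octonion R)%type)) :
  (x, y) != 0 -> (a, b) != 0 -> spin9hat A ->
  hopf (x, y) = hopf (a, b) -> hopf (A (x, y)) = hopf (A (a, b)).
Proof. by move=> _ _ sA; rewrite -hopf_spin9hat. Qed.
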